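(* Let $\mathbf u=\mathbf u(\Delta, \Theta)$ be a ternary generalized pseudostandard word over $\{0,1,2\}$ with directive bi-sequence $\Delta=\delta_1\delta_2\ldots$, $\Theta=\vartheta_1\vartheta_2\ldots$. Then $\mathbf u$ is periodic if and only if one of the following conditions is met: 1. The sequences $\Delta$ and $\Theta$ are eventually constant, i.e., $\Delta=va^{\omega}$ for some $v \in \{0,1,2\}^*$ and $a \in \{0,1,2\}$, and $\Theta=\sigma \vartheta^{\omega}$ for some $\sigma \in \{E_0, E_1, E_2, R\}^*$ and $\vartheta \in \{E_0, E_1, E_2, R\}$. 2. (i) $\Theta$ contains exactly two distinct antimorphisms $\vartheta$ and $R$ infinitely many times; (ii) $\Delta$ contains two (not necessarily distinct) letters $a$ and $b$ infinitely many times such that $\vartheta(a)=b$; and (iii) there exists $n_0 \in \mathbb N$ such that either for every $n>n_0$ we have ($\vartheta_n=\vartheta \Rightarrow \delta_{n+1}=a$ and $\vartheta_n=R \Rightarrow \delta_{n+1}=b$), or for every $n>n_0$ we have ($\vartheta_n=\vartheta \Rightarrow \delta_{n+1}=b$ and $\vartheta_n=R \Rightarrow \delta_{n+1}=a$). 3. The normalized directive bi-sequence $(\widetilde{\Delta}, \widetilde{\Theta})$ of $\mathbf u$ satisfies $(\widetilde{\Delta}, \widetilde{\Theta})=(v(ijk)^{\omega}, \sigma(E_k E_j E_i)^{\omega})$, where $v \in \{0,1,2\}^*$, $\sigma \in \{E_0, E_1, E_2, R\}^*$, $|v|=|\sigma|$, and $i,j,k \in \{0,1,2\}$ are mutually different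 letters.
   Context: An involutory antimorphism on $\mathcal A^*$ is a map $\vartheta:\mathcal A^*\to\mathcal A^*$ with $\vartheta(vw)=\vartheta(w)\vartheta(v)$ for all $v,w$ and $\vartheta^2=\mathrm{id}$; it is determined by its values on letters. Over $\mathcal A=\{0,1,2\}$ there are exactly four: the reversal $R$ fixing every letter, and, for $i\in\{0,1,2\}$, the exchange antimorphism $E_i$, which fixes the letter $i$ and exchanges the other two letters. A finite word $w$ is a $\vartheta$-palindrome if $w=\vartheta(w)$. The $\vartheta$-palindromic closure $w^{\vartheta}$ of $w$ is the shortest $\vartheta$-palindrome having $w$ as a prefix. Given $\Delta=\delta_1\delta_2\ldots$ with $\delta_i\in\{0,1,2\}$ and $\Theta=\vartheta_1\vartheta_2\ldots$ with $\vartheta_i\in\{R,E_0,E_1,E_2\}$, the generalized pseudostandard word $\mathbf u(\Delta,\Theta)$ is the infinite word whose prefixes $w_n$ are given by $w_0=\varepsilon$ (the empty word), $w_{n+1}=(w_n\delta_{n+1})^{\vartheta_{n+1}}$. The pair $(\Delta,\Theta)$ is its directive bi-sequence. A directive bi-sequence is normalized if the associated sequence $(w_n)_{n\ge 0}$ contains all prefixes of $\mathbf u(\Delta,\Theta)$ that are $\vartheta$-palindromes for some $\vartheta\in\{R,E_0,E_1,E_2\}$. Every generalized pseudostandard word has a normalized directive bi-sequence generating it; this is what is meant by its normalized directive bi-sequence. $x^\omega$ denotes infinite repetition of $x$. An infinite word is eventually periodic if it has the form $wv^{\omega}$ with $w,v$ finite words, $v$ nonempty, and purely periodic if $w$ can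 be taken empty; it is aperiodic if it is not eventually periodic. Generalized pseudostandard words are either aperiodic or purely periodic, so ''periodic'' may be understood as purely (equivalently, eventually) periodic. *)

(* Defs.v *)
From mathcomp Require Import all_boot all_algebra all_fingroup.

Set Implicit Arguments.
Unset Strict Implicit.
Unset Printing Implicit Defensive.

Notation letter := 'I_3.

(* The four involutory antimorphisms over the ternary alphabet; see
   [antim_classification] for the fact that there are no others. *)
Inductive antim := R | E of letter.

(* Addition is that of Z/3, so i + 1 and i + 2 are the two letters other
   than i. *)
Definition antim_letter (t : antim) : letter -> letter :=
  match t with
  | R => id
  | E i => tperm (i + 1)%R (i + 2%:R)%R
  end.

Definition antim_word (t : antim) (w : seq letter) : seq letter :=
  rev (map (antim_letter t) w).

Coercion antim_word : antim >-> Funclass.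

Definition palindrome (t : antim) (w : seq letter) : bool := w == t w.

Lemma antim_letterE i (x : letter) : antim_letter (E i) x = (- (x + i))%R.
Proof.
rewrite /antim_letter; case: tpermP => [->|->|].
- by apply/eqP; case: i => [[|[|[|]]]].
- by apply/eqP; case: i => [[|[|[|]]]].
move=> /eqP h1 /eqP h2; apply/eqP; move: h1 h2.
by case: i => [[|[|[|]]]] //= hi; case: x => [[|[|[|]]]].
Qed.

Lemma antim_letterK t : involutive (antim_letter t).
Proof. by case: t => [|i] x //=; rewrite tpermK. Qed.

Lemma antim_cat (t : antim) v w : t (v ++ w) = t w ++ t v.
Proof. by rewrite /antim_word map_cat rev_cat. Qed.

Lemma antim_invol (t : antim) : involutive t.
Proof. by move=> w; rewrite /antim_word map_rev revK mapK //; apply: antim_letterK. Qed.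

Lemma size_antim (t : antim) w : size (t w) = size w.
Proof. by rewrite size_rev size_map. Qed.

Lemma antim_classification (f : seq letter -> seq letter) :
  (forall v w, f (v ++ w) = f w ++ f v) -> involutive f ->
  exists t : antim, f =1 t.
Proof.
move=> fM fK.
have f0 : f [::] = [::].
  by apply/nilP; rewrite /nilp -(eqn_add2l (size (f [::]))) -size_cat -fM addn0.
have szf w : size w <= size (f w).
  elim: w => [|x w IH] //; rewrite -cat1s fM !size_cat addnC leq_add //.
  by case e: (f [:: x]) => //; move: (fK [:: x]); rewrite e f0.
have sz w : size (f w) = size w.
  by apply/eqP; rewrite eqn_leq szf andbT -{2}(fK w) szf.
pose g x := head x (f [:: x]).
have fg x : f [:: x] = [:: g x].
  by rewrite /g; case: (f [:: x]) (sz [:: x]) => [|y []].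
have gK : involutive g.
  by move=> x; have := fK [:: x]; rewrite !fg => -[].
suff [t gt] : exists t, g =1 antim_letter t.
  exists t => w; elim: w => [|x w IH]; first by rewrite f0.
  by rewrite -cat1s fM antim_cat IH fg gt.
have gI := inv_inj gK.
have fin (h : letter -> letter) : g ord0 = h ord0 ->
    g (inord 1) = h (inord 1) -> g (inord 2) = h (inord 2) -> g =1 h.
  move=> h0 h1 h2 [[|[|[|]]] //= hx].
  - by rewrite (_ : Ordinal hx = ord0) //; apply: val_inj.
  - by rewrite (_ : Ordinal hx = inord 1) //; apply: val_inj; rewrite /= inordK.
  - by rewrite (_ : Ordinal hx = inord 2) //; apply: val_inj; rewrite /= inordK.
have o1 : inord 1 = 1%R :> letter by apply: val_inj; rewrite /= inordK.
have o2 : inord 2 = 2%:R%R :> letter by apply: val_inj; rewrite /= inordK.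
have tri (x : letter) : [\/ x = 0%R, x = 1%R | x = 2%:R%R].
  case: x => [[|[|[|]]] //= hx]; [apply: Or31|apply: Or32|apply: Or33];
  exact: val_inj.
rewrite o1 o2 in fin.
case: (tri (g 0%R)) (tri (g 1%R)) (tri (g 2%:R%R)) => e0 [] e1 [] e2;
 try (by move: (gI _ _ (etrans e0 (esym e1))));
 try (by move: (gI _ _ (etrans e0 (esym e2))));
 try (by move: (gI _ _ (etrans e1 (esym e2))));
 try (by move: (gK 0%R) (gK 1%R) (gK 2%:R%R); rewrite ?(e0, e1, e2)).
- by exists R; apply: fin.
- by exists (E 0%R); apply: fin; rewrite antim_letterE ?(e0, e1, e2); apply: val_inj.
- by exists (E 2%:R%R); apply: fin; rewrite antim_letterE ?(e0, e1, e2); apply: val_inj.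
- by exists (E 1%R); apply: fin; rewrite antim_letterE ?(e0, e1, e2); apply: val_inj.
Qed.

Definition closure_at (t : antim) (w : seq letter) (m : nat)
    (p : m.-tuple letter) : bool :=
  prefix w p && palindrome t p.

Lemma closure_ex (t : antim) w :
  exists m, [exists p : m.-tuple letter, closure_at t w p].
Proof.
exists (size (w ++ t w)); apply/existsP; exists (in_tuple (w ++ t w)).
by rewrite /closure_at /= prefix_prefix /palindrome antim_cat antim_invol eqxx.
Qed.

Lemma closure_min_ex (t : antim) w :
  exists p : (ex_minn (closure_ex t w)).-tuple letter, closure_at t w p.
Proof. by case: ex_minnP => m /existsP. Qed.

Definition pal_closure (t : antim) (w : seq letter) : seq letter :=
  xchoose (closure_min_ex t w).

Lemma closureP (t : antim) w :
  [/\ prefix w (pal_closure t w), palindrome t (pal_closure t w)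
    & forall p, prefix w p -> palindrome t p -> size (pal_closure t w) <= size p].
Proof.
have /andP[pw pp] := xchooseP (closure_min_ex t w).
split=> // p wp tp; rewrite /pal_closure size_tuple.
case: ex_minnP => m _; apply; apply/existsP; exists (in_tuple p).
exact/andP.
Qed.

Lemma closure_uniq (t : antim) w p :
  prefix w p -> palindrome t p ->
  (forall q, prefix w q -> palindrome t q -> size p <= size q) ->
  p = pal_closure t w.
Proof.
move=> wp tp pmin; have [wc tc cmin] := closureP t w.
have esz : size p = size (pal_closure t w).
  by apply/eqP; rewrite eqn_leq pmin // cmin.
have le2 : size p <= size w + size w.
  rewrite -{2}(size_antim t w) -size_cat; apply: pmin; first exact: prefix_prefix.
  by rewrite /palindrome antim_cat antim_invol.
have half q : prefix w q -> palindrome t q -> size q = size p ->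
    q = take (size p) (w ++ drop (size w + size w - size p) (t w)).
  move=> /prefixP[s ->] /eqP e; rewrite size_cat => es.
  have le_s : size s <= size w by rewrite -es leq_add2l in le2.
  rewrite take_oversize; last first.
    rewrite size_cat size_drop size_antim -es subnDl.
    by rewrite subKn.
  congr (_ ++ _); rewrite -es subnDl.
  have e2 : drop (size w) (w ++ s) = drop (size w) (t s ++ t w).
    by rewrite e antim_cat.
  rewrite drop_size_cat // drop_cat size_antim ltnNge le_s /= in e2.
  exact: e2.
by rewrite (half p) // (half _ wc tc) // -esz.
Qed.

(* Directive sequences are indexed from 0: [D n] is the letter delta_(n+1) and
   [T n] is the antimorphism theta_(n+1). *)
Fixpoint pal_prefix (D : nat -> letter) (T : nat -> antim) (n : nat) :
    seq letter :=
  if n is m.+1 then pal_closure (T m) (rcons (pal_prefix D T m) (D m)) else [::].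

(* The word whose prefixes are the [pal_prefix D T n]; see [pseudostandardP].
   The default [ord0] is never used, as [pal_prefix D T n.+1] has more than n
   letters. *)
Definition pseudostandard (D : nat -> letter) (T : nat -> antim) :
    nat -> letter :=
  fun n => nth ord0 (pal_prefix D T n.+1) n.

Definition is_prefix (w : seq letter) (u : nat -> letter) : Prop :=
  w = mkseq u (size w).

Lemma pal_prefixS D T n :
  prefix (rcons (pal_prefix D T n) (D n)) (pal_prefix D T n.+1).
Proof. by case: (closureP (T n) (rcons (pal_prefix D T n) (D n))). Qed.

Lemma size_pal_prefix D T n : n <= size (pal_prefix D T n).
Proof.
elim: n => // n IH; apply: leq_ltn_trans IH _.
by have := size_prefix (pal_prefixS D T n); rewrite size_rcons.
Qed.

Lemma pal_prefix_le D T m n :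
  m <= n -> prefix (pal_prefix D T m) (pal_prefix D T n).
Proof.
move=> /subnK <-; elim: (n - m) => [|k IH]; first exact: prefix_refl.
apply: prefix_trans IH _; rewrite addSn.
by apply: prefix_trans (pal_prefixS D T _); apply: prefix_rcons.
Qed.

Lemma pseudostandardP D T n :
  is_prefix (pal_prefix D T n) (pseudostandard D T).
Proof.
apply: (@eq_from_nth _ ord0) => [|i lt_i]; first by rewrite size_mkseq.
rewrite nth_mkseq // /pseudostandard.
have lt_i' := size_pal_prefix D T i.+1.
case/orP: (leq_total n i.+1) => /(pal_prefix_le D T)/prefixP[s ->];
  by rewrite nth_cat ?lt_i ?lt_i'.
Qed.

Definition normalized (D : nat -> letter) (T : nat -> antim) : Prop :=
  forall (t : antim) (w : seq letter),
    is_prefix w (pseudostandard D T) -> palindrome t w ->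
    exists n, w = pal_prefix D T n.

(* [omega x s] is the infinite repetition of the nonempty word x s. *)
Definition omega (A : Type) (x : A) (s : seq A) : nat -> A :=
  fun n => nth x (x :: s) (n %% (size s).+1).

Definition wcat (A : Type) (v : seq A) (u : nat -> A) : nat -> A :=
  fun n => nth (u (n - size v)) v n.

Definition periodic (u : nat -> letter) : Prop :=
  exists (x : letter) (s : seq letter), u =1 omega x s.

Definition infinitely_often (A : Type) (u : nat -> A) (a : A) : Prop :=
  forall N, exists2 n, N <= n & u n = a.

(* Main.v *)
(* A long palindromic prefix of a periodic word u is the trace of a reflection
   symmetry of the whole periodic word.  The letter following a T-palindromic
   prefix is then T(x), where x is the last letter of the period, and the types
   of the palindromic prefixes are governed by an infinite dihedral group: they
   are eventually constant, or R and one exchange, or they run cyclically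
   through the three exchanges.
   Conversely, each of the three conditions provides a letter x such that every
   late directive prefix w of type T is followed by T(x).  Then x w T(x) is a
   T-palindromic prefix of x u, and each of these longer palindromes is the
   shortest proper palindromic extension of the previous one.  The composition of
   two neighbouring reflections is a translation whose length d and letter map
   turn out not to change, so that u has period 6 d. *)

Require Import Defs.
From mathcomp Require Import all_boot all_algebra all_fingroup.
From mathcomp Require Import zify.
From Stdlib Require Import Classical.

Set Implicit Arguments.
Unset Strict Implicit.
Unset Printing Implicit Defensive.

(** * Palindromic prefixes and normalization *)

(** The part of the [t]-symmetry of length [m] that is visible on the first [N] letters, that is,
    what these letters must satisfy to extend to a [t]-palindrome of length [m]. *)
Definition mirror (u : nat -> letter) (t : antim) (m N : nat) : Prop :=
  forall i j, i < N -> j < N -> i + j.+1 = m -> u i = antim_letter t (u j).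

Definition pal (u : nat -> letter) (t : antim) (m : nat) : Prop :=
  forall i j, i + j.+1 = m -> u i = antim_letter t (u j).

Lemma pal_mirror u t m N : pal u t m -> mirror u t m N.
Proof. by move=> um i j _ _; apply: um. Qed.

(** The two [s]-reflections, of lengths [a] and [b], compose to a translation by [b - a] with
    trivial letter map. It carries the [t]-reflection of length [c] down to [c - (b - a)]. *)
Lemma mirror_shift u s t N a b c :
  N <= a -> a <= b -> b <= c ->
  mirror u s a N -> pal u s b -> pal u t c -> mirror u t (c - (b - a)) N.
Proof.
move=> Na ab bc ua ub uc i j iN jN ij.
rewrite (uc i (j + (b - a))); last lia.
congr antim_letter.
rewrite (ub _ (a - j.+1)); last lia.
by rewrite (ua j (a - j.+1)) //; lia.
Qed.

Lemma nth_antim (t : antim) w i j :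
  i + j.+1 = size w -> nth ord0 (t w) i = antim_letter t (nth ord0 w j).
Proof.
move=> ij; rewrite nth_rev size_map; last lia.
by rewrite (nth_map ord0); [congr (_ (nth _ _ _)); lia | lia].
Qed.

Lemma palindromeP (t : antim) w :
  reflect (pal (nth ord0 w) t (size w)) (palindrome t w).
Proof.
apply: (iffP eqP) => [e i j ij|h]; first by rewrite {1}e (nth_antim _ ij).
apply: (@eq_from_nth _ ord0) => [|i lt_i]; first by rewrite size_antim.
have ij : i + (size w - i.+1).+1 = size w by lia.
by rewrite (nth_antim _ ij); apply: h.
Qed.

Lemma palindrome_mkseq u t m : palindrome t (mkseq u m) <-> pal u t m.
Proof.
split=> [/palindromeP h i j ij | h].
  by have := h i j; rewrite size_mkseq !nth_mkseq; [apply | lia | lia].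
apply/palindromeP => i j; rewrite size_mkseq => ij.
by rewrite !nth_mkseq; [apply: h | lia | lia].
Qed.

Lemma size_closure_le t w m :
  size w <= m -> mirror (nth ord0 w) t m (size w) -> size (pal_closure t w) <= m.
Proof.
move=> le_m sym; have [_ _ cmin] := closureP t w.
(* From twice the size on, [w ++ t w] is short enough. Below, [w] overlaps its image and only its
   first [m - size w] letters remain to be reflected. *)
have [le2|lt2] := leqP (size w + size w) m.
  apply: leq_trans le2; rewrite -{2}(size_antim t w) -size_cat.
  by apply: cmin; rewrite ?prefix_prefix // /palindrome antim_cat antim_invol.
pose q := w ++ t (take (m - size w) w).
have sz_take : size (take (m - size w) w) = m - size w by rewrite size_takel; lia.
have sz_q : size q = m by rewrite size_cat size_antim sz_take; lia.
rewrite -[X in _ <= X]sz_q; apply: cmin; first exact: prefix_prefix.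
have right i j : i < size w -> size w <= j -> i + j.+1 = m ->
    nth ord0 q j = antim_letter t (nth ord0 q i).
  move=> lt_i le_j ij; rewrite !nth_cat lt_i ltnNge le_j /=.
  rewrite (@nth_antim _ _ _ i); last by rewrite sz_take; lia.
  by rewrite nth_take //; lia.
apply/palindromeP => i j; rewrite sz_q => ij.
have [lt_i|le_i] := ltnP i (size w); have [lt_j|le_j] := ltnP j (size w).
- by rewrite !nth_cat lt_i lt_j; apply: sym.
- by rewrite (right i j) // antim_letterK.
- by apply: right => //; lia.
- by lia.
Qed.

Lemma prefix_mkseq (u : nat -> letter) m w :
  prefix w (mkseq u m) -> w = mkseq u (size w).
Proof.
move=> wm; have le_m := size_prefix wm; rewrite size_mkseq in le_m.
apply: (@eq_from_nth _ ord0) => [|i lt_i]; first by rewrite size_mkseq.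
case/prefixP: wm => s e; have : nth ord0 (mkseq u m) i = nth ord0 w i.
  by rewrite e nth_cat lt_i.
by rewrite nth_mkseq ?nth_mkseq // ?(leq_trans lt_i).
Qed.

Lemma mkseq_prefix (u : nat -> letter) m n :
  m <= n -> prefix (mkseq u m) (mkseq u n).
Proof.
move=> le_mn; rewrite prefixE size_mkseq /mkseq -map_take take_iota.
by rewrite (minn_idPl le_mn).
Qed.

Section Prefixes.

Variables (D : nat -> letter) (T : nat -> antim).
Let u := pseudostandard D T.
Let l n := size (pal_prefix D T n).

Lemma pal_prefixE n : pal_prefix D T n = mkseq u (l n).
Proof. exact: pseudostandardP. Qed.

Lemma rcons_pal_prefix n : rcons (pal_prefix D T n) (D n) = mkseq u (l n).+1.
Proof.
have := pal_prefixS D T n; rewrite [X in prefix _ X]pal_prefixE.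
by move/prefix_mkseq => e; rewrite {1}e size_rcons.
Qed.

Lemma directive_letter n : D n = u (l n).
Proof.
by have := rcons_pal_prefix n; rewrite pal_prefixE mkseqS => /rcons_inj[].
Qed.

Lemma pal_prefix_closure n :
  pal_prefix D T n.+1 = pal_closure (T n) (mkseq u (l n).+1).
Proof. by rewrite -rcons_pal_prefix. Qed.

Lemma pal_prefix_pal n : pal u (T n) (l n.+1).
Proof.
apply/palindrome_mkseq; rewrite -pal_prefixE pal_prefix_closure.
by case: (closureP (T n) (mkseq u (l n).+1)).
Qed.

Lemma lt_size_pal_prefix n : l n < l n.+1.
Proof. by have := size_prefix (pal_prefixS D T n); rewrite size_rcons. Qed.

Lemma le_size_pal_prefix m n : m <= n -> l m <= l n.
Proof. by move=> /(pal_prefix_le D T)/size_prefix. Qed.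

(* A shorter closure of [mkseq u p.+1] would, by [mirror_shift], also shorten
   the closure step from the n-th to the (n+1)-st directive prefix. *)
Lemma closure_between n t p p' :
  l n <= p -> p < p' -> p' <= l n.+1 -> pal u t p' ->
  mkseq u p' = pal_closure t (mkseq u p.+1).
Proof.
move=> np pp' p'n up'; apply: closure_uniq.
- exact: mkseq_prefix.
- exact/palindrome_mkseq.
move=> q pq tq; rewrite size_mkseq leqNgt; apply/negP => lt_q.
have le_q := size_prefix pq; rewrite size_mkseq in le_q.
have uq : mirror u t (size q) p.+1.
  move=> i j ip jp /(palindromeP _ _ tq).
  case/prefixP: pq => s ->.
  by rewrite !nth_cat size_mkseq ip jp !nth_mkseq.
have := mirror_shift le_q (ltnW lt_q) p'n uq up' (@pal_prefix_pal n).
set m := (l n.+1 - _) => um.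
have [pc tc _] := closureP (T n) (mkseq u p.+1).
have : size (pal_closure (T n) (mkseq u p.+1)) <= m.
  apply: size_closure_le; rewrite size_mkseq; first by rewrite /m; lia.
  by move=> i j ip jp ij; rewrite !nth_mkseq //; apply: um.
have [_ _ /(_ _ _ tc)] := closureP (T n) (mkseq u (l n).+1).
rewrite -pal_prefix_closure -/(l _); have := mkseq_prefix u (np : (l n).+1 <= p.+1).
by move=> /prefix_trans/(_ pc) pre /(_ pre) h /(leq_trans h); rewrite /m; lia.
Qed.

Lemma interval_pal_prefix p : exists n, l n <= p < l n.+1.
Proof.
have ex : exists n, p < l n by exists p.+1; apply: size_pal_prefix.
case: (ex_minnP ex) => -[|n] lt_p min; first by rewrite /l in lt_p.
by exists n; rewrite lt_p andbT leqNgt; apply/negP => /min; rewrite ltnn.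
Qed.

(** List the lengths [k n] of all palindromic prefixes of [u] in increasing order. No directive
    prefix lies strictly between two successive ones, so [closure_between] makes each the closure of
    its predecessor. *)
Lemma normalized_exists :
  exists D' T', pseudostandard D' T' =1 u /\ normalized D' T'.
Proof.
pose ts := R :: map E (enum letter).
have tsP t : exists2 i, i < size ts & nth R ts i = t.
  case: t => [|i]; first by exists 0.
  have i_lt : i < size (enum letter) by rewrite -cardE card_ord.
  by exists i.+1; [rewrite /= size_map | rewrite /= (nth_map ord0) // nth_ord_enum].
pose p t m := palindrome t (mkseq u m).
pose palb m := has (p^~ m) ts.
have palbP m : palb m <-> exists t, pal u t m.
  split=> [/(has_nthP R)[i _ h]|[t h]].
    by exists (nth R ts i); apply/palindrome_mkseq.
  apply/(has_nthP R); have [i lt_i e] := tsP t; exists i => //.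
  by rewrite e; apply/palindrome_mkseq.
have ex m : exists m', (m < m') && palb m'.
  exists (l m.+1); apply/andP; split; first exact: size_pal_prefix.
  by apply/palbP; exists (T m); exact: (@pal_prefix_pal m).
pose next m := ex_minn (ex m).
pose k n := iter n next 0.
(* A prefix may be a palindrome of several types; the first one in [ts] is taken. The default [R] is
   never reached. *)
pose T' n := nth R ts (find (p^~ (k n.+1)) ts).
pose D' n := u (k n).
have nextP m : [/\ m < next m, palb (next m) & forall m', m < m' -> palb m' -> next m <= m'].
  rewrite /next; case: ex_minnP => m' /andP[lt_m pm] min; split=> // x lt_x px.
  by apply: min; rewrite lt_x.
have T'P n : pal u (T' n) (k n.+1).
  have [_ h _] := nextP (k n).
  by apply/palindrome_mkseq; apply: (nth_find R (a := p^~ (k n.+1))).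
have k_ge n : n <= k n.
  by elim: n => // n IH; have [h _ _] := nextP (k n); rewrite /= -/(k n); lia.
have WE n : pal_prefix D' T' n = mkseq u (k n).
  elim: n => [//|n IH]; rewrite [LHS]/= IH.
  have -> : rcons (mkseq u (k n)) (D' n) = mkseq u (k n).+1.
    by rewrite mkseqS.
  have [lt_k _ min] := nextP (k n); have [m /andP[le_m lt_m]] := interval_pal_prefix (k n).
  symmetry; apply: (closure_between le_m lt_k) => //; apply: min => //.
  by apply/palbP; exists (T m); exact: (@pal_prefix_pal m).
have uE : pseudostandard D' T' =1 u.
  by move=> n; rewrite /pseudostandard WE nth_mkseq.
exists D', T'; split=> // t w wE tw.
have {}wE : w = mkseq u (size w) by rewrite {1}wE; apply: eq_mkseq.
have pw : pal u t (size w) by apply/palindrome_mkseq; rewrite -wE.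
have [e|sz_gt0] := posnP (size w); first by exists 0; rewrite (size0nil e).
have ex_k : exists n, size w <= k n by exists (size w).
(* With [k n < size w <= k n.+1], minimality of the next palindromic length forces equality on the
   right. *)
case: (ex_minnP ex_k) => -[|n] le_k min; first by move: le_k; rewrite /=; lia.
exists n.+1; rewrite WE wE; congr mkseq; apply/eqP; rewrite eqn_leq le_k /=.
have [_ _] := nextP (k n); apply; last by apply/palbP; exists t.
by rewrite ltnNge; apply/negP => /min; rewrite ltnn.
Qed.

End Prefixes.

(** * Chains of closures *)

Lemma pal_translation u s t m n i :
  pal u s m -> pal u t n -> m <= n -> i < m ->
  u (i + (n - m)) = antim_letter t (antim_letter s (u i)).
Proof.
move=> us ut mn im; rewrite (us i (m - i.+1)); last lia.
by rewrite antim_letterK; apply: ut; lia.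
Qed.

(** Conjugation of reflections: the image of the [s]-symmetry at [q] under the [r]-symmetry at [m]
    sits at [m + m - q] and has type [r s r = t]. *)
Lemma mirror_reflect u r s t m q :
  (forall x, antim_letter s x =
     antim_letter r (antim_letter t (antim_letter r x))) ->
  pal u r m -> q <= m -> pal u s q -> mirror u t (m + m - q) m.
Proof.
move=> conj ur qm us i j im jm ij.
rewrite (ur i (m - i.+1)); last lia.
rewrite (us _ (m - j.+1)); last lia.
rewrite conj antim_letterK; congr antim_letter.
by symmetry; apply: ur; lia.
Qed.

Lemma pal_reflect u r s t m q :
  (forall x, antim_letter s x =
     antim_letter r (antim_letter t (antim_letter r x))) ->
  pal u r m -> q <= m -> mirror u t (m + m - q) m -> pal u s q.
Proof.
move=> conj ur qm ut i j ij.
rewrite conj (ur i (m - i.+1)); last lia.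
congr antim_letter; rewrite -(ur (m - j.+1)); last lia.
by apply: ut; lia.
Qed.

(** A product of two letter maps is a permutation of three letters, so its order divides 6. *)
Lemma antim_letter_order6 s t :
  (fun x => iter 6 (antim_letter s \o antim_letter t) x) =1 id.
Proof.
have E0 i x : antim_letter (E i) x = (- (x + i))%R := antim_letterE i x.
move=> x /=; case: s t => [|a] [|b]; rewrite ?E0 /=; apply/eqP.
- by [].
- by case: b x => [[|[|[|//]]] ?] [[|[|[|//]]] ?].
- by case: a x => [[|[|[|//]]] ?] [[|[|[|//]]] ?].
- by case: a b x => [[|[|[|//]]] ?] [[|[|[|//]]] ?] [[|[|[|//]]] ?].
Qed.

Lemma periodic_of_period u p :
  0 < p -> (forall i, u (i + p) = u i) -> periodic u.
Proof.
move=> p_gt0 up; exists (u 0), (mkseq (fun i => u i.+1) p.-1) => n.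
rewrite /omega size_mkseq prednK //.
have -> : u 0 :: mkseq (fun i => u i.+1) p.-1 = mkseq u p.
  apply: (@eq_from_nth _ ord0) => [|[|i]]; rewrite /= ?size_mkseq ?prednK //.
    by move=> _; rewrite nth_mkseq.
  by move=> lt_i; rewrite nth_mkseq ?nth_mkseq //; lia.
rewrite nth_mkseq ?ltn_mod //.
rewrite {1}(divn_eq n p) addnC.
by elim: (n %/ p) => [|k IH]; rewrite ?addn0 // mulSn addnCA addnC up.
Qed.

(** The letter at index 0 is dropped because the lemma is applied to words of the form
    [prepend x u]. *)
Lemma periodic_of_translation u s t d :
  0 < d -> (forall i, u (i + d) = antim_letter s (antim_letter t (u i))) ->
  periodic (fun i => u i.+1).
Proof.
move=> d_gt0 ud; apply: (@periodic_of_period _ (6 * d)) => [|i]; first lia.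
rewrite -[RHS](antim_letter_order6 s t).
have -> : (i + 6 * d).+1 = i.+1 + d + d + d + d + d + d by lia.
by rewrite !ud.
Qed.

(* Unlike [pal_closure], one step of a chain never returns its argument: it is
   the shortest [t n.+1]-palindrome strictly longer than the previous prefix. *)
Definition closure_chain u (t : nat -> antim) (M : nat -> nat) : Prop :=
  forall n, [/\ pal u (t n) (M n), 0 < M n, M n < M n.+1
    & forall m, M n < m -> mirror u (t n.+1) m (M n) -> M n.+1 <= m].

Section Chain.

Variables (u : nat -> letter) (t : nat -> antim) (M : nat -> nat).
Hypothesis chain : closure_chain u t M.

Lemma chain_ge n : n <= M n.
Proof. by elim: n => // n IH; have [_ _ h _] := chain n; lia. Qed.

Lemma chain_step_le s n q :
  (forall x, antim_letter s x =
     antim_letter (t n) (antim_letter (t n.+1) (antim_letter (t n) x))) ->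
  q < M n -> pal u s q -> M n.+1 <= M n + M n - q.
Proof.
move=> conj lt_q us; have [un _ _ min] := chain n.
by apply: min; [lia | apply: mirror_reflect conj un _ us; lia].
Qed.

Lemma chain_step_pal s n :
  (forall x, antim_letter s x =
     antim_letter (t n) (antim_letter (t n.+1) (antim_letter (t n) x))) ->
  M n.+1 <= M n + M n /\ pal u s (M n + M n - M n.+1).
Proof.
move=> conj; have [un M_gt0 lt_M min] := chain n; have [un1 _ _ _] := chain n.+1.
have le_M : M n.+1 <= M n + M n.
  (* At length [M n + M n] the mirror condition on the first [M n] letters is vacuous. *)
  by apply: min => [|i j im jm ij]; lia.
split=> //; apply: pal_reflect conj un _ _; first lia.
by rewrite subKn //; apply: pal_mirror.
Qed.

(** Reflection in [M n] exchanges [s]-palindromic prefixes and candidates for the next step, so the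
    longest proper one, [q], determines [M n.+1]. *)
Lemma chain_step_eq s n q :
  (forall x, antim_letter s x =
     antim_letter (t n) (antim_letter (t n.+1) (antim_letter (t n) x))) ->
  q < M n -> pal u s q -> (forall m, q < m -> m < M n -> ~ pal u s m) ->
  M n.+1 = M n + M n - q.
Proof.
move=> conj lt_q us no; have le1 := chain_step_le conj lt_q us.
have [le2 up] := chain_step_pal conj; have [_ _ lt_M _] := chain n.
have [lt|ge] := ltnP q (M n + M n - M n.+1); last lia.
by case: (no _ lt _ up); lia.
Qed.

Lemma no_pal_step n m : M n < m -> m < M n.+1 -> ~ pal u (t n.+1) m.
Proof.
move=> lt1 lt2 um; have [_ _ _ min] := chain n.
by have := min m lt1 (pal_mirror um); lia.
Qed.

(** The symmetries at [k] and [m] would give a translation by [m - k], which would shorten the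
    minimal step to [M n.+1]. *)
Lemma no_pal_shift n s k m :
  M n <= k -> mirror u s k (M n) -> k < m -> m < M n.+1 -> ~ pal u s m.
Proof.
move=> le_k uk lt1 lt2 um; have [_ _ _ min] := chain n.
have [un1 _ _ _] := chain n.+1.
have := mirror_shift le_k (ltnW lt1) (ltnW lt2) uk um un1.
by move/min; lia.
Qed.

(** Reflecting [M n] in [M n.+1] gives exactly [M n.+2], so the lengths form an arithmetic
    progression. Successive reflections then compose to the same translation on ever longer
    prefixes. *)
Lemma chain_translation s1 s2 :
  (forall n x, antim_letter (t n) x =
     antim_letter (t n.+1) (antim_letter (t n.+2) (antim_letter (t n.+1) x))) ->
  (forall n m, M n < m -> m < M n.+1 -> ~ pal u (t n) m) ->
  (forall n x, antim_letter (t n.+1) (antim_letter (t n) x) =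
     antim_letter s2 (antim_letter s1 x)) ->
  exists2 d, 0 < d &
    forall i, u (i + d) = antim_letter s2 (antim_letter s1 (u i)).
Proof.
move=> conj no tE; exists (M 1 - M 0); first by have [_ _ h _] := chain 0; lia.
have dE n : M n.+1 - M n = M 1 - M 0.
  elim: n => // n <-; have [un _ lt1 _] := chain n; have [_ _ lt2 _] := chain n.+1.
  by have := chain_step_eq (conj n) lt1 un (no n); lia.
(* Step [i.+1] is used because its prefix is longer than [i]. *)
move=> i; rewrite -(dE i.+1) -(tE i.+1).
have [u1 _ lt_M _] := chain i.+1; have [u2 _ _ _] := chain i.+2.
by apply: pal_translation u1 u2 _ _; [lia | have := chain_ge i.+1; lia].
Qed.

End Chain.

(** * Chains mixing [R] with one other antimorphism *)

Section MixedChain.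

Variables (u : nat -> letter) (t : nat -> antim) (M : nat -> nat) (theta : antim).
Hypothesis chain : closure_chain u t M.
Hypothesis t_in : forall n, t n = theta \/ t n = R.
Hypothesis moved : exists2 i, i < M 0 & antim_letter theta (u i) <> u i.

Definition complementary (a b : antim) : Prop :=
  (a = theta /\ b = R) \/ (a = R /\ b = theta).

Lemma complementaryP a b : complementary a b ->
  [/\ complementary b a,
      forall x, antim_letter b x =
        antim_letter a (antim_letter b (antim_letter a x)),
      forall x, antim_letter a x =
        antim_letter a (antim_letter a (antim_letter a x)),
      forall x, antim_letter a (antim_letter b x) = antim_letter theta x
    & forall x, antim_letter a (antim_letter theta x) = antim_letter b x].
Proof.
by rewrite /complementary => -[[-> ->]|[-> ->]]; split=> [|x|x|x|x];
  rewrite ?antim_letterK /= ?antim_letterK; auto.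
Qed.

(** A common palindrome of both types would make [theta] fix each of its letters, against
    [moved]. *)
Lemma no_double_pal n a b m :
  M n <= m -> complementary a b -> pal u a m -> ~ pal u b m.
Proof.
move=> le_m ab ua ub; case: moved => i lt_i.
have lt_im : i < m.
  apply: leq_trans lt_i (leq_trans _ le_m).
  elim: n {le_m} => // n IH; have [_ _ h _] := chain n; lia.
have ij : i + (m - i.+1).+1 = m by lia.
have [_ _ _ _ _] := complementaryP ab; apply.
by move: (ua _ _ ij) (ub _ _ ij); case: ab => -[-> ->] /= e1 e2; congruence.
Qed.

(** Symmetries of the two types alternate at distance [d]: below [M n], the longest palindromic
    prefix of the other type has length [M n - d], that of the same type [M n - (d + d)]. *)
Definition chain_inv n d : Prop :=
  exists a b, [/\ complementary a b, t n = a,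
    [/\ 0 < d, d + d <= M n, pal u b (M n - d) & pal u a (M n - (d + d))],
    forall m, M n - d < m -> m < M n -> ~ pal u a m /\ ~ pal u b m
  & forall m, M n - (d + d) < m -> m < M n -> ~ pal u a m].

(** At a change of type [d] is the step just made, and reflecting [M n.+1] back in [M n] supplies
    the third palindrome. *)
Lemma chain_inv_init n : t n <> t n.+1 -> exists d, chain_inv n.+1 d.
Proof.
move=> neq; have [un M_gt0 lt_M _] := chain n.
have ab : complementary (t n) (t n.+1).
  rewrite /complementary.
  case: (t_in n) (t_in n.+1) => [] e1 [] e2; rewrite e1 e2 in neq *; by [case: neq|auto].
have [ba conj _ _ _] := complementaryP ab.
have [le_M uq] := chain_step_pal chain conj.
exists (M n.+1 - M n), (t n.+1), (t n); split=> //.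
- split; [lia | lia | |].
  + by rewrite subKn //; lia.
  + by have -> : M n.+1 - (M n.+1 - M n + (M n.+1 - M n)) = M n + M n - M n.+1 by lia.
- move=> m m1 m2; split; first by apply: (no_pal_step chain (n := n)) => //; lia.
  apply: (no_pal_shift chain (n := n) (k := M n)) => //; last lia.
  exact: pal_mirror.
- move=> m m1 m2 um; case: (ltngtP m (M n)) => [lt|gt|e].
  + by have := chain_step_le chain conj lt um; lia.
  + by apply: (no_pal_step chain (n := n)) um.
  + by apply: (@no_double_pal n _ _ m _ ba um); rewrite ?e.
Qed.

Lemma chain_invS n d : chain_inv n d -> chain_inv n.+1 d.
Proof.
move=> [a [b [ab tn [d_gt0 le_d ub ua] no no_a]]].
have [ba conj_b conj_a abE aE] := complementaryP ab.
have [un M_gt0 lt_M _] := chain n; rewrite tn in un.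
have : t n.+1 = a \/ t n.+1 = b.
  by case: ab => -[-> ->]; case: (t_in n.+1); auto.
case=> tn1; last first.
  (* The type changes: the step is [d]. *)
  rewrite -tn1 -tn in conj_b.
  have ME : M n.+1 = M n + d.
    have -> : M n + d = M n + M n - (M n - d) by lia.
    apply: (chain_step_eq chain conj_b) => [||m m1 m2]; rewrite ?tn1 //; first lia.
    by case: (no m m1 m2).
  have no_b m : M n < m -> m < M n.+1 -> ~ pal u b m.
    by rewrite -tn1; apply: (no_pal_step chain).
  exists b, a; rewrite ME; split=> //.
  - split=> //; [lia | by rewrite addnK |].
    by have -> : M n + d - (d + d) = M n - d by lia.
  - move=> m m1 m2; split; first by apply: no_b; lia.
    apply: (no_pal_shift chain (n := n) (k := M n)) => //; [exact: pal_mirror | lia | lia].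
  - move=> m m1 m2 um; case: (ltngtP m (M n)) => [lt|gt|e].
    + by case: (no m _ lt) => //; lia.
    + by apply: (no_b m) => //; lia.
    + by apply: (@no_double_pal n _ _ m _ ba um); rewrite ?e.
(* The type is repeated: the step is [d + d], and the [b]-palindrome of length [M n + d], skipped by
   the chain, has to be recovered. *)
have conj : forall x, antim_letter a x =
     antim_letter (t n) (antim_letter (t n.+1) (antim_letter (t n) x)).
  by rewrite tn tn1.
have ME : M n.+1 = M n + (d + d).
  have -> : M n + (d + d) = M n + M n - (M n - (d + d)) by lia.
  by apply: (chain_step_eq chain conj) => //; lia.
have [un1 _ _ _] := chain n.+1; rewrite tn1 ME in un1.
have tr i : i + d < M n -> u (i + d) = antim_letter theta (u i).
  move=> lt_i; have := pal_translation ub un _ (_ : i < M n - d).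
  have -> : M n - (M n - d) = d by lia.
  by rewrite abE; apply; lia.
have outer i j : i + j.+1 = M n + d -> i < d -> u j = antim_letter b (u i).
  move=> ij lt_i; rewrite (un1 j (i + d)); last lia.
  by rewrite tr ?aE //; lia.
(* Pairs with an index below [d] come from the reflection of length [M n + (d + d)]; the others from
   the one of length [M n] followed by the translation by [d]. *)
have umid : pal u b (M n + d).
  move=> i j ij; have [lt_i|le_i] := ltnP i d.
    by rewrite (outer i j) // antim_letterK.
  have [lt_j|le_j] := ltnP j d; first by apply: outer => //; lia.
  rewrite (un i (j - d)); last lia.
  rewrite -aE; congr antim_letter.
  rewrite -{2}(subnK le_j) tr ?antim_letterK //; lia.
have no_a' m : M n < m -> m < M n.+1 -> ~ pal u a m.
  by rewrite -tn1; apply: (no_pal_step chain).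
exists a, b; rewrite ME; split=> //.
- split=> //; [lia | | by rewrite addnK].
  by have -> : M n + (d + d) - d = M n + d by lia.
- move=> m m1 m2; split; first by apply: no_a'; lia.
  apply: (no_pal_shift chain (n := n) (k := M n + d)); [lia | exact: pal_mirror | lia | lia].
- by move=> m m1 m2; apply: no_a'; lia.
Qed.

(** The invariant keeps the same [d] forever, and the reflections at [M n - d] and [M n] compose to
    a translation by [d] with letter map [theta]. *)
Lemma mixed_chain_translation :
  (exists n, t n <> t n.+1) ->
  exists2 d, 0 < d & forall i, u (i + d) = antim_letter theta (u i).
Proof.
move=> [n /chain_inv_init[d inv_d]].
have inv k : chain_inv (n.+1 + k) d.
  by elim: k => [|k IH]; rewrite ?addn0 // addnS; apply: chain_invS.
exists d => [|i]; first by have [a [b [_ _ []]]] := inv 0.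
have [a [b [ab tk [_ le_d ub _] _ _]]] := inv (i + d).
have [un _ _ _] := chain (n.+1 + (i + d)); rewrite tk in un.
have [_ _ _ <- _] := complementaryP ab.
have := chain_ge chain (n.+1 + (i + d)) => ge_M.
have := pal_translation ub un _ (_ : i < M (n.+1 + (i + d)) - d).
have -> : M (n.+1 + (i + d)) - (M (n.+1 + (i + d)) - d) = d by lia.
by apply; lia.
Qed.

End MixedChain.

(** * The exchanges as transpositions of Z/3 *)

Local Arguments antim_letter : simpl never.

(** Conjugating one transposition of three letters by another gives the third; equivalently, the two
    products are the same 3-cycle. *)
Lemma exchange_cycle (i j k x : letter) : uniq [:: i; j; k] ->
  antim_letter (E i) x =
    antim_letter (E j) (antim_letter (E k) (antim_letter (E j) x)) /\
  antim_letter (E j) (antim_letter (E k) x) =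
    antim_letter (E i) (antim_letter (E j) x).
Proof.
rewrite !antim_letterE => h; split; apply/eqP; move: i j k x h.
all: by move=> [[|[|[|//]]] ?] [[|[|[|//]]] ?] [[|[|[|//]]] ?] [[|[|[|//]]] ?].
Qed.

Lemma exchange_inj (i j x : letter) :
  antim_letter (E i) x = antim_letter (E j) x -> i = j.
Proof. by rewrite !antim_letterE => /GRing.oppr_inj/GRing.addrI. Qed.

(** The two sides are [x + j - i] and [x + i - j], and 2 is invertible in Z/3. *)
Lemma exchange_comm_inj (i j x : letter) :
  antim_letter (E i) (antim_letter (E j) x) =
    antim_letter (E j) (antim_letter (E i) x) -> i = j.
Proof.
rewrite !antim_letterE => /eqP h; apply/eqP; move: i j x h.
by move=> [[|[|[|//]]] ?] [[|[|[|//]]] ?] [[|[|[|//]]] ?].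
Qed.

Lemma exchange_fix (i j : letter) : antim_letter (E i) j = j <-> i = j.
Proof.
rewrite antim_letterE; split=> [/eqP h|->]; apply/eqP.
  by move: i j h => [[|[|[|//]]] ?] [[|[|[|//]]] ?].
by case: j => [[|[|[|//]]] ?].
Qed.

Lemma exchange_other (i j k : letter) : uniq [:: i; j; k] ->
  antim_letter (E i) j = k.
Proof.
rewrite antim_letterE => h; apply/eqP; move: i j k h.
by move=> [[|[|[|//]]] ?] [[|[|[|//]]] ?] [[|[|[|//]]] ?].
Qed.

Lemma third_letter (i j : letter) : i != j -> exists k, uniq [:: k; j; i].
Proof.
(* The three letters sum to 0, so the third is [- (j + i)]. *)
by move=> ij; exists (antim_letter (E i) j); rewrite antim_letterE; move: i j ij;
  move=> [[|[|[|//]]] ?] [[|[|[|//]]] ?].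
Qed.

Lemma uniq3_mem (i j k x : letter) : uniq [:: i; j; k] -> x \in [:: i; j; k].
Proof.
by move: i j k x => [[|[|[|//]]] ?] [[|[|[|//]]] ?] [[|[|[|//]]] ?] [[|[|[|//]]] ?].
Qed.

(** * Eventually periodic and recurrent sequences *)

Lemma wcat_ge (A : Type) (v : seq A) f n : wcat v f (size v + n) = f n.
Proof. by rewrite /wcat nth_default ?leq_addr // addKn. Qed.

Lemma wcat_mkseq (A : Type) (f g : nat -> A) n :
  (forall r, f (n + r) = g r) -> f =1 wcat (mkseq f n) g.
Proof.
move=> fg m; have [lt_m|le_m] := ltnP m n.
  by rewrite /wcat nth_mkseq.
by rewrite -(subnKC le_m) -[X in wcat _ _ (X + _)](size_mkseq f n) wcat_ge fg.
Qed.

Lemma omega1 (A : Type) (a : A) n : omega a [::] n = a.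
Proof. by rewrite /omega modn1. Qed.

Lemma omega3 (A : Type) (f : nat -> A) :
  (forall n, f n.+3 = f n) -> f =1 omega (f 0) [:: f 1; f 2].
Proof.
move=> f3 n; rewrite /omega {1}(divn_eq n 3) addnC.
have -> : f (n %% 3 + n %/ 3 * 3) = f (n %% 3).
  elim: (n %/ 3) => [|k IH]; first by rewrite addn0.
  by rewrite mulSn addnCA f3.
by case: (n %% 3) (ltn_pmod n (isT : 0 < 3)) => [|[|[|]]].
Qed.

Lemma eventually_recurrent (t : nat -> antim) :
  exists N, forall n, N <= n -> infinitely_often t (t n).
Proof.
have ev s : exists N, forall n, N <= n -> t n = s -> infinitely_often t s.
  have [io|/not_all_ex_not[N hN]] := classic (infinitely_often t s).
    by exists 0.
  by exists N => n le_n tn; case: hN; exists n.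
have [NR hR] := ev R.
have [N hN] : exists N : letter -> nat, forall i n,
    N i <= n -> t n = E i -> infinitely_often t (E i).
  have [N hN] := fin_all_exists (fun i => ev (E i)).
  by exists N.
exists (maxn NR (\max_i N i)) => n; rewrite geq_max => /andP[le_R le_E].
case e: (t n) => [|i]; first exact: hR e.
by apply: (hN i n) e; apply: leq_trans le_E; apply: leq_bigmax.
Qed.

Lemma eq_periodic u u' : u =1 u' -> periodic u -> periodic u'.
Proof. by move=> uu' [x [s us]]; exists x, s => n; rewrite -uu'. Qed.

(** * Periodicity from each of the three conditions *)

Definition prepend (x : letter) (u : nat -> letter) : nat -> letter :=
  fun n => if n is m.+1 then u m else x.

(* If the letter after every late T-palindrome w is T(x), then x w T(x) is again
   a T-palindrome: the next directive prefix becomes a closure of this word. *)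
Lemma directive_chain D T x n0 :
  (forall n, n0 <= n -> D n.+1 = antim_letter (T n) x) ->
  closure_chain (prepend x (pseudostandard D T)) (fun n => T (n0 + n))
    (fun n => (size (pal_prefix D T (n0 + n).+1)).+2).
Proof.
move=> Dx n; cbv beta; rewrite !addnS.
have dl := directive_letter D T (n0 + n).+1; rewrite Dx ?leq_addr // in dl.
split=> //.
- have := pal_prefix_pal (D := D) (T := T) (n := n0 + n).
  move: dl; set l := size _ => dl ul [|i] [|j] //=.
  + by rewrite add0n => -[->]; rewrite -dl antim_letterK.
  + by rewrite addn1 => -[->]; rewrite -dl.
  + by move=> ij; apply: ul; lia.
- by rewrite !ltnS; apply: lt_size_pal_prefix.
move=> m lt_m um; suff : size (pal_prefix D T (n0 + n).+2) <= m - 2 by lia.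
rewrite pal_prefix_closure; apply: size_closure_le; rewrite size_mkseq; first lia.
move=> i j lt_i lt_j ij; rewrite !nth_mkseq //.
by apply: (um i.+1 j.+1); rewrite ?ltnS //; lia.
Qed.

Lemma periodic_const D T v a sigma theta :
  D =1 wcat v (omega a [::]) -> T =1 wcat sigma (omega theta [::]) ->
  periodic (pseudostandard D T).
Proof.
move=> DE TE; pose n0 := size v + size sigma.
have Tn n : T (n0 + n) = theta.
  by rewrite TE /n0 [size v + _]addnC -addnA wcat_ge omega1.
(* The prepended letter is [theta(a)], whose image under [theta] is [a]. *)
have Dn n : n0 <= n -> D n.+1 = antim_letter (T n) (antim_letter theta a).
  move=> le_n; rewrite -(subnKC le_n) Tn antim_letterK DE /n0 -addnA -addnS.
  by rewrite wcat_ge omega1.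
have chain := directive_chain Dn.
have [||n|d d_gt0 ud] := chain_translation (s1 := theta) (s2 := theta) chain.
- by move=> n x; rewrite !Tn antim_letterK.
- by move=> n m m1 m2; have := no_pal_step chain m1 m2; rewrite !Tn.
- by rewrite !Tn.
exact: periodic_of_translation ud.
Qed.

Lemma periodic_mixed D T theta x n0 :
  theta <> R -> (forall t, infinitely_often T t <-> t = theta \/ t = R) ->
  (forall n, n0 <= n -> T n = theta -> D n.+1 = antim_letter theta x) ->
  (forall n, n0 <= n -> T n = R -> D n.+1 = x) ->
  periodic (pseudostandard D T).
Proof.
move=> thR io D1 D2; pose u := pseudostandard D T.
(* If [theta] moves no letter, it is some [E c] and the word is constantly [c]. Otherwise the chain
   starts late enough for its first prefix to contain the moved letter. *)
have [[i ui]|fixed] := classic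
  (exists i, antim_letter theta (prepend x u i) <> prepend x u i); last first.
  apply: (periodic_of_period (p := 1)) => // n.
  have {}fixed m : antim_letter theta (u m) = u m.
    by apply: NNPP => h; apply: fixed; exists m.+1.
  case: theta thR fixed {io D1} => // c _ fixed.
  by move: (fixed n) (fixed (n + 1)) => /exchange_fix e1 /exchange_fix e2; rewrite -/u -e1 -e2.
have [N hN] := eventually_recurrent T.
pose n1 := n0 + N + i.
have T_in n : n1 <= n -> T n = theta \/ T n = R.
  by move=> le_n; apply/io/hN; rewrite /n1 in le_n; lia.
have Dn n : n1 <= n -> D n.+1 = antim_letter (T n) x.
  move=> le_n; have le_n0 : n0 <= n by rewrite /n1 in le_n; lia.
  by case: (T_in n le_n) => e; rewrite e; [apply: D1|apply: D2].
have chain := directive_chain Dn.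
have [|||d d_gt0 ud] := mixed_chain_translation (theta := theta) chain.
- by move=> n; apply: T_in; apply: leq_addr.
- exists i => //; have := size_pal_prefix D T (n1 + 0).+1.
  by rewrite /n1; lia.
- apply: NNPP => no.
  have {}no n : T (n1 + n) = T n1.
    elim: n => [|n IH]; first by rewrite addn0.
    by rewrite -IH; symmetry; apply: NNPP => h; apply: no; exists n.
  have /io/(_ n1)[n2 le2 e2] : theta = theta \/ theta = R by left.
  have /io/(_ n1)[n3 le3 e3] : R = theta \/ R = R by right.
  by apply: thR; rewrite -e2 -e3 -(subnKC le2) -(subnKC le3) !no.
by apply: (periodic_of_translation (s := theta) (t := R)) ud.
Qed.

Lemma normalized_no_pal D T n t m : normalized D T ->
  size (pal_prefix D T n) < m -> m < size (pal_prefix D T n.+1) ->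
  ~ pal (pseudostandard D T) t m.
Proof.
move=> norm m1 m2 /palindrome_mkseq um.
have [|k e] := norm t _ _ um; first by rewrite /is_prefix size_mkseq.
have := congr1 size e; rewrite size_mkseq => em; rewrite {}em in m1 m2.
have [le|lt] := leqP k n; first by have := le_size_pal_prefix D T le; lia.
by have := le_size_pal_prefix D T lt; lia.
Qed.

Lemma periodic_cycle D T v sigma i j k :
  normalized D T -> size v = size sigma -> uniq [:: i; j; k] ->
  D =1 wcat v (omega i [:: j; k]) -> T =1 wcat sigma (omega (E k) [:: E j; E i]) ->
  periodic (pseudostandard D T).
Proof.
move=> norm sz ijk DE TE; pose n0 := size v.
have mod3 n : [\/ [/\ n %% 3 = 0, n.+1 %% 3 = 1 & n.+2 %% 3 = 2],
    [/\ n %% 3 = 1, n.+1 %% 3 = 2 & n.+2 %% 3 = 0]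
  | [/\ n %% 3 = 2, n.+1 %% 3 = 0 & n.+2 %% 3 = 1]].
  have : n %% 3 = 0 \/ n %% 3 = 1 \/ n %% 3 = 2 by lia.
  by move=> [|[|]] h; [apply: Or31|apply: Or32|apply: Or33]; split; lia.
have Tn n : T (n0 + n) = nth (E k) [:: E k; E j; E i] (n %% 3).
  by rewrite TE /n0 sz wcat_ge.
(* The prepended letter is [i]: the types [E k], [E j], [E i] send it to [j], [k], [i], the letters
   one step later. *)
have Dn n : n0 <= n -> D n.+1 = antim_letter (T n) i.
  move=> le_n; rewrite -(subnKC le_n) Tn DE /n0 -addnS wcat_ge /omega /=.
  have [jik kij] : uniq [:: j; i; k] /\ uniq [:: k; i; j].
    by split; rewrite -(perm_uniq (s1 := [:: i; j; k])) //; apply/seq.permP => P /=; lia.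
  case: (mod3 (n - n0)) => -[-> -> _] /=.
  - by rewrite (exchange_other kij).
  - by rewrite (exchange_other jik).
  - by rewrite (exchange_fix i i).2.
have chain := directive_chain Dn.
have [jki kij] : uniq [:: j; k; i] /\ uniq [:: k; i; j].
  by split; rewrite -(perm_uniq (s1 := [:: i; j; k])) //; apply/seq.permP => P /=; lia.
have [||n x|d d_gt0 ud] := chain_translation (s1 := E k) (s2 := E j) chain.
- move=> n x; rewrite !Tn.
  have [kji jik ikj] : [/\ uniq [:: k; j; i], uniq [:: j; i; k] & uniq [:: i; k; j]].
    by split; rewrite -(perm_uniq (s1 := [:: i; j; k])) //; apply/seq.permP => P /=; lia.
  have [c1 _] := exchange_cycle x kji; have [c2 _] := exchange_cycle x jik.
  have [c3 _] := exchange_cycle x ikj.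
  by case: (mod3 n) => -[-> -> ->].
(* Without its outer letters, such a palindrome would be a palindromic prefix strictly between two
   directive ones, which normalization forbids. *)
- move=> n m m1 m2 um.
  apply: (@normalized_no_pal D T (n0 + n).+1 (T (n0 + n)) (m - 2)) => //.
  + by lia.
  + by move: m2; rewrite addnS; lia.
  + by move=> a b ab; apply: (um a.+1 b.+1); lia.
- rewrite !Tn.
  have [_ c1] := exchange_cycle x ijk; have [_ c2] := exchange_cycle x jki.
  have [_ c3] := exchange_cycle x kij.
  by case: (mod3 n) => -[-> -> _] /=; congruence.
exact: periodic_of_translation ud.
Qed.

(** * Reflections of a periodic word *)

Section PeriodicWord.

Variables (u : nat -> letter) (p : nat).
Hypotheses (p_gt0 : 0 < p) (up : forall n, u (n + p) = u n).

(** A symmetry of the two-sided periodic extension of [u]; only [m] modulo [p] matters. *)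
Definition reflection t m : Prop :=
  forall i j, i + j.+1 = m %[mod p] -> u i = antim_letter t (u j).

Lemma period_modn i j : i = j %[mod p] -> u i = u j.
Proof.
have um n : u n = u (n %% p).
  rewrite {1}(divn_eq n p) addnC; elim: (n %/ p) => [|k IH]; first by rewrite addn0.
  by rewrite mulSn addnCA addnC up.
by move=> ij; rewrite um ij -um.
Qed.

Lemma reflection_pal t m : reflection t m -> pal u t m.
Proof. by move=> ut i j ij; apply: ut; rewrite ij. Qed.

Lemma pal_reflection t m : p <= m -> pal u t m -> reflection t m.
Proof.
move=> le_m ut i j ij; have lt_i := ltn_pmod i p_gt0.
rewrite (@period_modn i (i %% p)) ?modn_mod // (ut _ (m - (i %% p).+1)); last lia.
congr antim_letter; apply: period_modn; apply/eqP.
rewrite -(eqn_modDl (i %% p).+1); have -> : (i %% p).+1 + (m - (i %% p).+1) = m by lia.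
by rewrite -ij addSnnS modnDml.
Qed.

Lemma reflection_translation s t m n i : reflection s m -> reflection t n ->
  u (i + n) = antim_letter t (antim_letter s (u (i + m))).
Proof.
(* This [j] represents [- i.+1] modulo [p], since [i + j.+1 = i.+1 * p]. *)
move=> us ut; pose j := i.+1 * p.-1.
have ij k : i + k + j.+1 = k %[mod p].
  have -> : i + k + j.+1 = i.+1 * p + k by rewrite /j; case: (p) p_gt0 => // q _; lia.
  by rewrite modnMDl.
by rewrite (us _ _ (ij m)) antim_letterK; apply: ut; apply: ij.
Qed.

Lemma reflection_conj r s t m n q :
  (forall x, antim_letter s x =
     antim_letter r (antim_letter t (antim_letter r x))) ->
  reflection r m -> reflection t n -> q + n = m + m -> reflection s q.
Proof.
(* [f k] is a natural number congruent to [m - k.+1], the mirror image of [k]. *)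
move=> conj ur ut qn i j ij; pose f k := m + k.+1 * p.-1.
have fP k : k + (f k).+1 = m %[mod p].
  have -> : k + (f k).+1 = k.+1 * p + m by rewrite /f; case: (p) p_gt0 => // r' _; lia.
  by rewrite modnMDl.
rewrite (ur _ _ (fP i)) conj; congr antim_letter.
rewrite (ur _ _ (fP j)) antim_letterK; apply: ut.
apply/eqP; rewrite -(eqn_modDl q) qn -modnDml -ij modnDml.
have -> : i + j.+1 + (f i + (f j).+1) = (i + j.+2) * p + (m + m).
  by rewrite /f; case: (p) p_gt0 => // q' _; lia.
by rewrite modnMDl.
Qed.

Lemma exchange_reflection_uniq i j m :
  reflection (E i) m -> reflection (E j) m -> i = j.
Proof.
move=> ui uj; have := reflection_translation 0 ui uj.
by move/(congr1 (antim_letter (E j))); rewrite antim_letterK => /esym; apply: exchange_inj.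
Qed.

(* The symmetries commute with translations, so the letter maps of any two
   translations commute; [E a E b] and [E b E a] never agree on a letter. *)
Lemma reflection_types a b m n q :
  reflection R m -> reflection (E a) n -> reflection (E b) q -> a = b.
Proof.
move=> uR ua ub; apply: (@exchange_comm_inj _ _ (u (m + m))).
have eA i := reflection_translation i uR ua.
have eB i := reflection_translation i uR ub.
have e1 : u (q + n) = antim_letter (E a) (antim_letter (E b) (u (m + m))).
  by rewrite eA [q + m]addnC eB.
by rewrite -e1 [q + n]addnC eB [n + m]addnC eA.
Qed.

End PeriodicWord.

(** * Normalized bi-sequences of periodic words with two exchange symmetries *)

Section NormalizedPeriodic.

Variables (D : nat -> letter) (T : nat -> antim) (p : nat).
Let u := pseudostandard D T.
Let l n := size (pal_prefix D T n).
Hypotheses (p_gt0 : 0 < p) (up : forall n, u (n + p) = u n).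

Lemma pal_prefix_reflection n : p <= n -> reflection u p (T n) (l n.+1).
Proof.
move=> le_n; apply: pal_reflection (pal_prefix_pal (n := n)) => //.
by apply: leq_trans (size_pal_prefix D T n.+1); lia.
Qed.

(** Index [p.-1] stands for position -1, which the reflection swaps with the position just after the
    prefix. *)
Lemma directive_letter_reflection n :
  p <= n -> D n.+1 = antim_letter (T n) (u p.-1).
Proof.
move=> /pal_prefix_reflection un; rewrite (directive_letter D T); apply: un.
by rewrite prednK // modnDr.
Qed.

Variables (a b : letter) (ma mb : nat).
Hypotheses (norm : normalized D T) (ab : a != b).
Hypotheses (ua : reflection u p (E a) ma) (ub : reflection u p (E b) mb).

Lemma exchange_type n : p <= n -> exists i, T n = E i.
Proof.
move=> /pal_prefix_reflection; case: (T n) => [uR|i _]; last by exists i.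
by move: ab; rewrite (reflection_types p_gt0 uR ua ub) eqxx.
Qed.

(** Equal types would make the step [d] a period. Translating another exchange symmetry by multiples
    of [d] brings it to a length in [[m, m')]: at [m] two exchanges coincide, beyond [m]
    normalization fails. *)
Lemma exchange_type_neq n i j : p <= n -> T n = E i -> T n.+1 = E j -> i != j.
Proof.
move=> le_n ti tj; apply/negP => /eqP ij.
have ui := pal_prefix_reflection le_n; rewrite ti in ui.
have uj := pal_prefix_reflection (leqW le_n); rewrite tj -ij in uj.
have [e [me [ie ue]]] : exists e me, i != e /\ reflection u p (E e) me.
  have [->|ne] := eqVneq i a; first by exists b, mb.
  by exists a, ma.
set m := l n.+1 in ui; set m' := l n.+2 in uj.
have lt_m : m < m' by apply: lt_size_pal_prefix.
have p_m : p <= m by apply: leq_trans (size_pal_prefix D T n.+1); lia.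
pose d := m' - m.
have ud k : u (k + d) = u k.
  have := reflection_translation p_gt0 (k + m * p.-1) ui uj; rewrite antim_letterK.
  have e1 : k + m * p.-1 + m' = k + d + m * p %[mod p].
    by congr (_ %% _); rewrite /d; case: (p) p_gt0 => // q _; lia.
  have e2 : k + m * p.-1 + m = k + m * p %[mod p].
    by congr (_ %% _); case: (p) p_gt0 => // q _; lia.
  rewrite (period_modn up e1) (period_modn up e2).
  rewrite (@period_modn _ _ up (k + d + m * p) (k + d)) 1?addnC ?modnMDl //.
  by rewrite (@period_modn _ _ up (k + m * p) k) // addnC modnMDl.
(* Adding [m * p] keeps the subtraction nonnegative without changing the reflection. *)
pose c := me + m * p - m; pose r := m + c %% d.
have d_gt0 : 0 < d by rewrite subn_gt0.
have ur : pal u (E e) r.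
  move=> x y xy; have -> : u x = u (x + c %/ d * d).
    elim: (c %/ d) => [|k IH]; first by rewrite addn0.
    by rewrite mulSn addnCA addnA [d + x]addnC -addnA [d + _]addnC addnA ud.
  apply: ue; have -> : x + c %/ d * d + y.+1 = m * p + me.
    have := divn_eq c d; rewrite /c.
    have : m <= m * p by rewrite leq_pmulr.
    by rewrite /r in xy; move: xy; rewrite -/c; lia.
  by rewrite modnMDl.
have lt_r : r < m' by have := ltn_pmod c d_gt0; rewrite /r /d; lia.
have [r0|r_gt0] := posnP (c %% d).
  rewrite /r r0 addn0 in ur; have {}ur := pal_reflection p_gt0 up p_m ur.
  by move: ie; rewrite (exchange_reflection_uniq p_gt0 ui ur) eqxx.
by apply: (normalized_no_pal norm (n := n.+1) _ lt_r ur); rewrite -/(l _) -/m /r; lia.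
Qed.

Lemma exchange_type_third n i j : p <= n -> T n = E i -> T n.+1 = E j ->
  exists2 k, T n.+2 = E k & uniq [:: k; j; i].
Proof.
move=> le_n ti tj; have ij := exchange_type_neq le_n ti tj.
have [k kji] := third_letter ij; exists k => //.
have ui := pal_prefix_reflection le_n; rewrite ti in ui.
have uj := pal_prefix_reflection (leqW le_n); rewrite tj in uj.
have le_n2 : p <= n.+2 by lia.
have uf := pal_prefix_reflection le_n2.
have [f tf] := exchange_type le_n2; rewrite tf in uf *.
have lt1 := lt_size_pal_prefix D T n.+1; have lt2 := lt_size_pal_prefix D T n.+2.
rewrite -!/(l _) in lt1 lt2.
pose r := l n.+2 + l n.+2 - l n.+1.
have ur : reflection u p (E k) r.
  apply: (reflection_conj p_gt0 _ uj ui); last by rewrite /r; lia.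
  by move=> x; have [] := exchange_cycle x kji.
(* A smaller [r] is a palindromic length before [l n.+3]. A larger one puts the image of [l n.+3]
   under reflection in [l n.+2] strictly between [l n.+1] and [l n.+2]. Normalization excludes
   both. *)
have : r = l n.+3.
  case: (ltngtP r (l n.+3)) => // [lt|gt].
    by case: (normalized_no_pal norm (n := n.+2) _ lt (reflection_pal ur)); rewrite /r -/(l _); lia.
  pose q := l n.+2 + l n.+2 - l n.+3.
  have uq : exists t, reflection u p t q.
    have conj (x : letter) : exists s, forall x, antim_letter s x =
     antim_letter (E j) (antim_letter (E f) (antim_letter (E j) x)).
      have [->|jf] := eqVneq f j; first by exists (E j) => y; rewrite antim_letterK.
      have [g gjf] := third_letter jf; exists (E g) => y.
      by have [] := exchange_cycle y gjf.
    have [s hs] := conj ord0; exists s.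
    by apply: (reflection_conj p_gt0 hs uj uf); rewrite /q; rewrite /r in gt; lia.
  have [s us] := uq; rewrite /r in gt.
  case: (normalized_no_pal norm (n := n.+1) _ _ (reflection_pal us));
    by rewrite /q -!/(l _); lia.
move=> re; rewrite re in ur.
by rewrite (exchange_reflection_uniq p_gt0 uf ur).
Qed.

Lemma normalized_cycle :
  exists (v : seq letter) (sigma : seq antim) (i j k : letter),
    [/\ size v = size sigma, uniq [:: i; j; k],
        D =1 wcat v (omega i [:: j; k])
      & T =1 wcat sigma (omega (E k) [:: E j; E i])].
Proof.
have Tcyc n : p <= n -> T n.+3 = T n.
  move=> le_n; have [i ti] := exchange_type le_n.
  have [j tj] := exchange_type (leqW le_n).
  have [k tk kji] := exchange_type_third le_n ti tj.
  have [h -> hkj] := exchange_type_third (leqW le_n) tj tk; rewrite ti; congr E.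
  have := uniq3_mem h kji; move: hkj; rewrite /= !inE !negb_or.
  by case: eqP => //= _; case: (h =P j) => //= _ _ /eqP.
(* Starting after the exchange that fixes [u p.-1] makes this letter the [i] of the cycle and aligns
   both sequences. *)
have [N le_N TN] : exists2 N, p <= N & T N = E (u p.-1).
  have [i ti] := exchange_type (leqnn p).
  have [j tj] := exchange_type (leqW (leqnn p)).
  have [k tk kji] := exchange_type_third (leqnn p) ti tj.
  have := uniq3_mem (u p.-1) kji; rewrite !inE => /or3P[]/eqP->.
  - by exists p.+2 => //; lia.
  - by exists p.+1 => //; lia.
  - by exists p.
have [k tk] := exchange_type (leqW le_N).
have [j tj jki] := exchange_type_third le_N TN tk.
have ijk : uniq [:: u p.-1; j; k].
  by rewrite -(perm_uniq (s1 := [:: j; k; u p.-1])) //; apply/seq.permP => P /=; lia.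
exists (mkseq D N.+1), (mkseq T N.+1), (u p.-1), j, k; split=> //.
- by rewrite !size_mkseq.
- have DT n : D (N.+1 + n) = antim_letter (T (N + n)) (u p.-1).
    by rewrite addSn; apply: directive_letter_reflection; lia.
  have [kij jik] : uniq [:: k; u p.-1; j] /\ uniq [:: j; u p.-1; k].
    by split; rewrite -(perm_uniq (s1 := [:: j; k; u p.-1])) //; apply/seq.permP => P /=; lia.
  apply: wcat_mkseq => r; have := @omega3 _ (fun n => D (N.+1 + n)) _ r.
  rewrite !DT addn0 addn1 addn2 TN tk tj (exchange_fix _ _).2 //.
  rewrite (exchange_other kij) (exchange_other jik); apply=> n.
  by rewrite !DT !addnS Tcyc //; lia.
apply: wcat_mkseq => r; have := @omega3 _ (fun n => T (N.+1 + n)) _ r.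
rewrite addn0 addn1 addn2 tk tj Tcyc // TN; apply=> n.
by rewrite !addnS Tcyc //; lia.
Qed.

End NormalizedPeriodic.

(** * Equivalence of periodicity with the three conditions *)

Theorem theorem17 (Delta : nat -> letter) (Theta : nat -> antim) :
  periodic (pseudostandard Delta Theta) <->
  [\/ (exists (v : seq letter) (a : letter), Delta =1 wcat v (omega a [::])) /\
      (exists (sigma : seq antim) (theta : antim),
          Theta =1 wcat sigma (omega theta [::])),
      (exists theta : antim,
        [/\ theta <> R,
            forall t : antim,
              infinitely_often Theta t <-> t = theta \/ t = R
          & exists a b : letter,
            [/\ infinitely_often Delta a,
                infinitely_often Delta b,
                theta [:: a] = [:: b]
              & exists n0 : nat,
                  (forall n, n0 <= n ->
                     (Theta n = theta -> Delta n.+1 = a) /\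
                     (Theta n = R -> Delta n.+1 = b)) \/
                  (forall n, n0 <= n ->
                     (Theta n = theta -> Delta n.+1 = b) /\
                     (Theta n = R -> Delta n.+1 = a))]])
    | (exists (D : nat -> letter) (T : nat -> antim),
        [/\ pseudostandard D T =1 pseudostandard Delta Theta,
            normalized D T
          & exists (v : seq letter) (sigma : seq antim) (i j k : letter),
            [/\ size v = size sigma,
                uniq [:: i; j; k],
                D =1 wcat v (omega i [:: j; k])
              & T =1 wcat sigma (omega (E k) [:: E j; E i])]])].
Proof.
split; last first.
  case=> [[[v [a DE]] [sigma [theta TE]]]|[theta [thR io [a [b [_ _ ab [n0 cond]]]]]]
         |[D [T [eq_u norm [v [sigma [i [j [k [sz ijk DE TE]]]]]]]]]].
  - exact: periodic_const DE TE.
  - have {}ab : antim_letter theta a = b by case: ab.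
    have ba : antim_letter theta b = a by rewrite -ab antim_letterK.
    (* The prepended letter is the one that follows the type [R]. *)
    case: cond => cond.
    + by apply: (periodic_mixed (x := b) (n0 := n0) thR io) => n /cond[];
        rewrite ?ba.
    + by apply: (periodic_mixed (x := a) (n0 := n0) thR io) => n /cond[];
        rewrite ?ab.
  - by apply: eq_periodic eq_u _; apply: periodic_cycle sz ijk DE TE.
move=> [x0 [s us]]; set u := pseudostandard Delta Theta in us.
pose p := (size s).+1; have p_gt0 : 0 < p by [].
have up n : u (n + p) = u n by rewrite !us /omega modnDr.
have [N io] := eventually_recurrent Theta.
pose n0 := maxn N p.
have refl n : n0 <= n -> reflection u p (Theta n) (size (pal_prefix Delta Theta n.+1)).
  by rewrite geq_max => /andP[_]; apply: pal_prefix_reflection.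
have DE n : n0 <= n -> Delta n.+1 = antim_letter (Theta n) (u p.-1).
  by rewrite geq_max => /andP[_]; apply: directive_letter_reflection.
have {}io n : n0 <= n -> infinitely_often Theta (Theta n).
  by rewrite geq_max => /andP[/io].
(* Beyond [n0] the types are constant, or include two different exchanges but not [R], or are [R]
   and a single exchange; these give the three conditions in the order 1, 3, 2. *)
have [const|/not_all_ex_not[n1 h1]] :=
  classic (forall n, n0 <= n -> Theta n = Theta n0).
  apply: Or31; split.
    exists (mkseq Delta n0.+1), (antim_letter (Theta n0) (u p.-1)).
    apply: wcat_mkseq => r; rewrite omega1 addSn DE ?leq_addr // const //.
    exact: leq_addr.
  exists (mkseq Theta n0), (Theta n0); apply: wcat_mkseq => r.
  by rewrite omega1 const ?leq_addr.
have {h1} [le1 neq1] : n0 <= n1 /\ Theta n1 <> Theta n0.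
  by split; [apply: NNPP|] => h; apply: h1 => ?.
have [[nR leR eR]|noR] := classic (exists2 n, n0 <= n & Theta n = R); last first.
  have ex n : n0 <= n -> exists i, Theta n = E i.
    by move=> le_n; case e: (Theta n) => [|i]; [case: noR; exists n | exists i].
  have [a ea] := ex n0 (leqnn _); have [b eb] := ex n1 le1.
  have ab : a != b by apply/eqP => ab; apply: neq1; rewrite ea eb ab.
  have ua := refl n0 (leqnn _); have ub := refl n1 le1; rewrite ea in ua; rewrite eb in ub.
  (* The two exchange symmetries belong to the word itself, so they carry over to its normalized
     bi-sequence. *)
  have [D [T [eq_u norm]]] := normalized_exists Delta Theta.
  apply: Or33; exists D, T; split=> //.
  apply: (normalized_cycle p_gt0 _ norm ab (ma := size (pal_prefix Delta Theta n0.+1))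
    (mb := size (pal_prefix Delta Theta n1.+1))).
  - by move=> n; rewrite !eq_u; apply: up.
  - by move=> i j ij; rewrite !eq_u; apply: ua.
  - by move=> i j ij; rewrite !eq_u; apply: ub.
have [n2 le2 [c ec]] : exists2 n, n0 <= n & exists c, Theta n = E c.
  case e0: (Theta n0) => [|c]; last by exists n0 => //; exists c.
  case e1: (Theta n1) => [|c]; last by exists n1 => //; exists c.
  by case: neq1; rewrite e1 e0.
have uR := refl nR leR; have uc := refl n2 le2; rewrite eR in uR; rewrite ec in uc.
have types n : n0 <= n -> Theta n = E c \/ Theta n = R.
  move=> le_n; have := refl n le_n; case: (Theta n) => [|i] ui; [by right|left].
  by rewrite (reflection_types p_gt0 uR uc ui).
have ioc : infinitely_often Theta (E c) by rewrite -ec; apply: io.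
have ioR : infinitely_often Theta R by rewrite -eR; apply: io.
have ioD t : infinitely_often Theta t -> infinitely_often Delta (antim_letter t (u p.-1)).
  move=> iot M; have [n] := iot (maxn M n0); rewrite geq_max => /andP[leM le0] e.
  by exists n.+1; [lia | rewrite DE // e].
apply: Or32; exists (E c); split=> // [t|].
  split=> [/(_ n0)[n le_n <-]|[->|->]] //; exact: types.
(* These are the letters forced after the types [E c] and [R]. *)
exists (antim_letter (E c) (u p.-1)), (u p.-1); split.
- exact: ioD.
- exact: (ioD R).
- by rewrite /antim_word /= antim_letterK.
- by exists n0; left => n /DE ->; split=> ->.
Qed.
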